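(* (Weak Duality) Let $z\in\Omega$ and $w\in\Theta$ be feasible solutions of (CLP) and (CDP), respectively. Then $G(w)\le F(z)$.
   Context: Setting: $T>0$, and $A:[0,T]\to\mathbb{R}^{m\times n}$, $b:[0,T]\to\mathbb{R}^m$, $c:[0,T]\to\mathbb{R}^n$ have measurable, essentially bounded entries. Primal problem (CLP): minimize $F(z)=\int_0^T c(t)^\top z(t)\,dt$ over $\Omega=\{z\in L^\infty([0,T];\mathbb{R}^n): A(t)z(t)\le b(t)\text{ a.e. in }[0,T]\}$ (inequalities componentwise). Dual problem (CDP): maximize $G(w)=\int_0^T b(t)^\top w(t)\,dt$ over $\Theta=\{w\in L^\infty([0,T];\mathbb{R}^m): A(t)^\top w(t)=c(t),\ w(t)\le 0\text{ a.e. in }[0,T]\}$. *)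

(* Defs.v *)
From mathcomp Require Import all_boot all_order all_algebra.
From mathcomp Require Import all_classical all_reals all_analysis.

Set Implicit Arguments.
Unset Strict Implicit.
Unset Printing Implicit Defensive.

Import Order.TTheory GRing.Theory Num.Theory.
Import numFieldNormedType.Exports.

Local Open Scope classical_set_scope.
Local Open Scope ring_scope.

(* R with the sigma-algebra of Lebesgue-measurable sets; the measurable structure
   that the library puts on R itself only has the Borel sets. *)
Notation lebR R := (caratheodory_type (@wlength R idfun)^*%mu).

Section CLP.
Context {R : realType}.
Variable T : R.

Definition horizon : set (lebR R) := [set` `[0, T]].

Definition ae_on (P : R -> Prop) : Prop :=
  {ae (@completed_lebesgue_measure R), forall t, horizon t -> P t}.

(* Entrywise membership in the library's L^oo. Functions on [0, T] are given as
   functions on R whose values off [0, T] are irrelevant: [\_] replaces them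
   by 0. *)
Definition Linfty {p q : nat} (f : R -> 'M[R]_(p, q)) : Prop :=
  forall i j, ((fun t : lebR R => f t i j) \_ horizon)
                \in Lfun (@completed_lebesgue_measure R) +oo%E.

Variables (m n : nat).
Variables (A : R -> 'M[R]_(m, n)) (b : R -> 'cV[R]_m) (c : R -> 'cV[R]_n).

Definition primal_objective (z : R -> 'cV[R]_n) : R :=
  \int[completed_lebesgue_measure]_(t in horizon) (((c t)^T *m z t) 0 0).
Definition primal_feasible : set (R -> 'cV[R]_n) :=
  [set z | Linfty z /\ ae_on (fun t => forall i, (A t *m z t) i 0 <= b t i 0)].

Definition dual_objective (w : R -> 'cV[R]_m) : R :=
  \int[completed_lebesgue_measure]_(t in horizon) (((b t)^T *m w t) 0 0).
Definition dual_feasible : set (R -> 'cV[R]_m) :=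
  [set w | Linfty w /\
    ae_on (fun t => (A t)^T *m w t = c t /\ forall i, w t i 0 <= 0)].

End CLP.

(* Main.v *)
(* Almost everywhere [b^T w <= (A z)^T w = z^T (A^T w) = c^T z], because [w <= 0]
   reverses [A z <= b]. Both sides are integrable, being essentially bounded on
   a set of finite measure, so the inequality can be integrated. *)

Require Import Defs.
From mathcomp Require Import all_boot all_order all_algebra.
From mathcomp Require Import all_classical all_reals all_analysis.
From mathcomp Require Import measurable_realfun ess_sup_inf.

Import Order.TTheory GRing.Theory Num.Theory.
Import numFieldNormedType.Exports.

Local Open Scope classical_set_scope.
Local Open Scope ring_scope.

Section general_measure.
Context {d : measure_display} {X : measurableType d} {R : realType}.
Variable mu : {measure set X -> \bar R}.
Implicit Types (D : set X) (f g : X -> R).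

(** The [+oo] norm is the essential supremum of [|f|]; when finite, it gives a real bound a.e. *)
Lemma Lfuny_ae_bounded f : f \in Lfun mu +oo%E ->
  exists M : R, {ae mu, forall x, `|f x| <= M}.
Proof.
rewrite inE => /andP[_]; rewrite inE /finite_norm /= unlock /=.
case: ifPn => [_ fy|mu0 _].
  by apply: (@ess_supr_bounded _ _ _ mu (fun x => `|f x|)).
(* [Lnorm] is [0] by convention on a null space, where any bound holds a.e. *)
exists 0, setT; split => //.
by apply/eqP; rewrite -measure_le0 leNgt.
Qed.

(** The product is a.e. dominated on [D] by a constant, which is integrable because [mu D] is
    finite. *)
Lemma Lfuny_mul_integrable D f g : measurable D -> (mu D < +oo)%E ->
  f \_ D \in Lfun mu +oo%E -> g \_ D \in Lfun mu +oo%E ->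
  mu.-integrable D (EFin \o (fun x => f x * g x)).
Proof.
move=> mD muD fL gL.
have [M fM] := Lfuny_ae_bounded _ fL; have [N gN] := Lfuny_ae_bounded _ gL.
have mf : measurable_fun D f.
  by apply/(measurable_restrictT _ mD); have /andP[/set_mem] := fL.
have mg : measurable_fun D g.
  by apply/(measurable_restrictT _ mD); have /andP[/set_mem] := gL.
have mfg : measurable_fun D (fun x => (f x * g x)%:E).
  by apply/measurable_EFinP; exact: measurable_funM.
apply/integrableP; split => //.
(* The absolute value makes the constant nonnegative: on a null space the a.e. bounds [M] and [N]
   may be negative. *)
apply: (@le_lt_trans _ _ (\int[mu]_(x in D) (`|M * N|)%:E)%E); last first.
  by rewrite integral_cst//; exact: lte_mul_pinfty.
apply: ae_ge0_le_integral => //.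
  exact: measurableT_comp.
apply: filterS2 fM gN => x /= + + Dx.
rewrite /patch mem_set// => fM gN.
by rewrite lee_fin normrM (le_trans _ (ler_norm _))// ler_pM.
Qed.

(** Deleting a null set [N] that contains every violation changes neither integral, and on [D]\[N]
    the inequality is pointwise. *)
Lemma ae_le_Rintegral D f g : measurable D ->
  mu.-integrable D (EFin \o f) -> mu.-integrable D (EFin \o g) ->
  {ae mu, forall x, D x -> f x <= g x} ->
  \int[mu]_(x in D) f x <= \int[mu]_(x in D) g x.
Proof.
move=> mD fi gi [N [mN muN fgN]].
rewrite /Rintegral (negligible_integral mN mD fi muN).
rewrite (negligible_integral mN mD gi muN).
have mDN : measurable (D `\` N) by exact: measurableD.
have DND : D `\` N `<=` D by exact: subDsetl.
apply: le_Rintegral => //; [exact: integrableS fi|exact: integrableS gi|].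
move=> x [Dx Nx]; apply: contrapT => fgx; apply: Nx.
by apply: fgN => /= /(_ Dx).
Qed.

End general_measure.

Section horizon.
Context {R : realType}.
Variable T : R.
Notation mu := (@completed_lebesgue_measure R).

Lemma measurable_horizon : measurable (horizon T).
Proof.
by apply: sub_caratheodory; exact: (@measurable_itv R `[0, T]).
Qed.

Lemma horizon_lty : (mu (horizon T) < +oo)%E.
Proof.
(* The completed measure and [lebesgue_measure] are convertible on this set, so the interval length
   formula applies. *)
change (@lebesgue_measure R [set` `[0%R, T]%R] < +oo)%E.
by rewrite lebesgue_measure_itv; case: ifP => _; rewrite ?ltry.
Qed.

(** The dot product is a finite sum of products of essentially bounded entries. *)
Lemma Linfty_dot_integrable n (u v : R -> 'cV[R]_n) :
  Linfty T u -> Linfty T v ->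
  mu.-integrable (horizon T) (EFin \o (fun t => ((u t)^T *m v t) 0 0)).
Proof.
move=> uL vL.
have -> : EFin \o (fun t => ((u t)^T *m v t) 0 0) =
    (fun t => \sum_(i < n) (u t i 0 * v t i 0)%:E)%E.
  apply/funext => t /=; rewrite mxE -sumEFin.
  by apply: eq_bigr => i _; rewrite mxE.
apply: integrable_sum => [|i _]; first exact: measurable_horizon.
apply: Lfuny_mul_integrable; [exact: measurable_horizon|exact: horizon_lty|..].
- exact: uL.
- exact: vL.
Qed.

End horizon.

Lemma weak_duality_pointwise {R : realFieldType} {m n : nat} (A : 'M[R]_(m, n))
    (b : 'cV[R]_m) (c : 'cV[R]_n) (z : 'cV[R]_n) (w : 'cV[R]_m) :
  (forall i, (A *m z) i 0 <= b i 0) ->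
  A^T *m w = c -> (forall i, w i 0 <= 0) ->
  (b^T *m w) 0 0 <= (c^T *m z) 0 0.
Proof.
move=> Azb <- w_le0; rewrite trmx_mul trmxK -mulmxA !mxE.
(* The sums are compared term by term, with the factor [w i 0 <= 0] moved to the left on both
   sides. *)
apply: ler_sum => i _; rewrite !mxE mulrC.
by have := Azb i; rewrite mxE; exact: ler_wnM2l.
Qed.

Theorem theorem4p1 (R : realType) (T : R) (hT : 0 < T) (m n : nat)
    (A : R -> 'M[R]_(m, n)) (b : R -> 'cV[R]_m) (c : R -> 'cV[R]_n)
    (hA : Linfty T A) (hb : Linfty T b) (hc : Linfty T c)
    (z : R -> 'cV[R]_n) (w : R -> 'cV[R]_m)
    (hz : z \in primal_feasible T A b) (hw : w \in dual_feasible T A c) :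
  dual_objective T b w <= primal_objective T c z.
Proof.
move: hz hw; rewrite !inE /primal_feasible /dual_feasible /ae_on.
move=> -[zL zP] [wL wP].
apply: ae_le_Rintegral; first exact: measurable_horizon.
1,2: exact: Linfty_dot_integrable.
(* Both feasibility conditions hold simultaneously for almost every [t] of the horizon. *)
apply: filterS2 zP wP => t zt wt Dt.
by have [Aw w0] := wt Dt; apply: weak_duality_pointwise (zt Dt) Aw w0.
Qed.
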